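(* For every $\beta>0$ and $\epsilon>0$, there is $C>0$ such that the following holds for every positive integer $n$. Suppose $B \subseteq \{\pm 1\}^n$ is a set with $|B|= 2^{\beta n}$, and $Y \in B$ is uniformly distributed. Then for all but at most $2^{(1-\beta + \epsilon)n}$ choices of $x\in \{\pm 1\}^n$, $$\max_{k \in \mathbb{Z}} \big| \Pr[\langle x,Y\rangle = k] - \Pr[\langle x,Y\rangle = k+4]\big| \leq \frac{C}{n}.$$ In particular, if $X$ is independent of $Y$ and uniformly distributed in a set $A\subseteq\{\pm1\}^n$ of size $2^{(1-\beta+2\epsilon)n}$, then $$\max_{k \in \mathbb{Z}} \big| \Pr[\langle X,Y\rangle = k] - \Pr[\langle X,Y\rangle = k+4]\big| \leq \frac{C}{n} + 2^{-\epsilon n}.$$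
   Context: $\langle x,y\rangle=\sum_{j=1}^n x_jy_j$. *)

(* Defs.v *)
From HB Require Import structures.
From mathcomp Require Export all_boot all_order all_algebra.
From mathcomp Require Export all_classical all_reals all_analysis.

Set Implicit Arguments.
Unset Strict Implicit.
Unset Printing Implicit Defensive.

Import Order.TTheory GRing.Theory Num.Theory.
Local Open Scope classical_set_scope.
Local Open Scope ring_scope.

Definition pm1 : Type := seq_sub [:: 1; -1 : int].

HB.instance Definition _ := Finite.on pm1.

Definition cube (n : nat) : Type := {ffun 'I_n -> pm1}.

HB.instance Definition _ n := Finite.on (cube n).

Lemma pm1_subproof : (1 : int) \in [:: 1; -1 : int].
Proof. by rewrite mem_head. Qed.

HB.instance Definition _ n :=
  isPointed.Build (cube n) [ffun=> SeqSub pm1_subproof].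

HB.instance Definition _ n := @isMeasurable.Build default_measure_display
  (cube n) discrete_measurable discrete_measurable0
  discrete_measurableC discrete_measurableU.

Definition inner n (x y : cube n) : int := \sum_(j < n) ssval (x j) * ssval (y j).

Section Probability.
Context d (T : measurableType d) (R : realType) (P : probability T R).

Definition Pr (S : set T) : R := fine (P S).

Definition uniform_on n (B : {set cube n}) (Y : {RV P >-> cube n}) : Prop :=
  forall y : cube n,
    Pr [set w | Y w = y] = if y \in B then #|B|%:R^-1 else 0.

Definition independent_RV d1 d2 (U1 : measurableType d1) (U2 : measurableType d2)
    (X : {RV P >-> U1}) (Y : {RV P >-> U2}) : Prop :=
  forall (E : set U1) (F : set U2), measurable E -> measurable F ->
    P ((X @^-1` E) `&` (Y @^-1` F)) = (P (X @^-1` E) * P (Y @^-1` F))%E.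

(* [max_{k in Z} |Pr[Z = k] - Pr[Z = k + 4]| <= c], with the bound on the
   maximum expressed as a bound for every k. *)
Definition max_gap4_le (Z : T -> int) (c : R) : Prop :=
  forall k : int, `|Pr [set w | Z w = k] - Pr [set w | Z w = k + 4]| <= c.

End Probability.

(* Main.v *)
Require Import Defs.
From mathcomp Require Import all_boot all_order all_algebra.
From mathcomp Require Import all_classical all_reals all_analysis.
From mathcomp Require Import ring lra zify.

(** Let f_theta(x) = sum_(y in B) e^(i theta <x, y>) and s = sin (2 theta). Induction on
    the dimension, splitting B by the first coordinate, gives
      sum_x |f_theta(x)|^(2m) <= (2K)^n |B|^(2m-1)
    for every K > 1, as soon as m exceeds a constant (depending on K) times 1/s^2. By
    Markov's inequality, |f_theta(x)| <= |B| exp(-c n s^2) for all but (2K^2)^n / |B|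
    points x. The difference Pr[<x,Y> = k] - Pr[<x,Y> = k+4] is an average over the
    4(n+1) frequencies theta_j = 2 pi j / (4(n+1)) of terms of size at most
    2 |sin (2 theta_j)| |f_theta_j(x)| / |B|, and the sum of |s_j| exp(-c n s_j^2) over j is
    bounded, which leaves O(1/n). The union bound over the frequencies is absorbed
    into 2^(eps n). *)

Set Implicit Arguments.
Unset Strict Implicit.
Unset Printing Implicit Defensive.

Import Order.TTheory GRing.Theory Num.Theory numFieldNormedType.Exports.
Local Open Scope ring_scope.

(** * Entropy inequalities for two-point distributions *)

Section TwoPoint.
Context {R : realType}.
Implicit Types a b mu nu z : R.

Lemma ln_le_subr1 a : 0 < a -> ln a <= a - 1.
Proof. by move=> a0; have := expR_ge1Dx (ln a); rewrite lnK ?posrE //; lra. Qed.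

(** This is ln t <= t - 1 at t = mu / a. Summed over both points of two distributions it says that
    relative entropy is nonnegative; with mu = 1 or 1/2 it bounds the entropy itself. *)
Lemma relative_entropy_ge a mu : 0 < a -> 0 < mu -> a - mu <= a * (ln a - ln mu).
Proof.
move=> a0 mu0; have := ln_le_subr1 (divr_gt0 mu0 a0).
rewrite ln_div ?posrE // -(ler_pM2l a0) => h.
have e : a * (mu / a - 1) = mu - a by field; rewrite gt_eqF.
by move: h; rewrite e; lra.
Qed.

Lemma exprn_ln a k : 0 < a -> a ^+ k = expR (k%:R * ln a).
Proof. by move=> a0; rewrite expRM_natl lnK ?posrE. Qed.

(** The right-hand side is a exp(z1) + b exp(z2), which is at least exp(a z1 + b z2) by convexity
    (tangent line at the mean). That exponent is a ln a + b ln b plus k times the relative entropy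
    of (a, b) with respect to (mu, nu). *)
Lemma two_point_exp a b mu nu k :
  0 < a -> 0 < b -> a + b = 1 -> 0 < mu -> 0 < nu -> mu + nu = 1 ->
  expR (a * ln a + b * ln b) <= a ^+ k.+2 / mu ^+ k + b ^+ k.+2 / nu ^+ k.
Proof.
move=> a0 b0 ab mu0 nu0 mn.
pose z1 := k.+1%:R * ln a - k%:R * ln mu; pose z2 := k.+1%:R * ln b - k%:R * ln nu.
have E (c l : R) : 0 < c -> 0 < l ->
    c ^+ k.+2 / l ^+ k = c * expR (k.+1%:R * ln c - k%:R * ln l).
  by move=> c0 l0; rewrite expRD expRN -(exprn_ln k.+1 c0) -(exprn_ln k l0) [c ^+ k.+2]exprS mulrA.
rewrite !E // -/z1 -/z2; set z0 := a * z1 + b * z2.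
have tangent z : expR z0 * (1 + (z - z0)) <= expR z.
  have -> : expR z = expR z0 * expR (z - z0) by rewrite -expRD subrKC.
  by rewrite ler_pM2l ?expR_gt0 // expR_ge1Dx.
apply: (@le_trans _ _ (expR z0)).
  rewrite ler_expR.
  have h : 0 <= a * (ln a - ln mu) + b * (ln b - ln nu).
    have := relative_entropy_ge a0 mu0; have := relative_entropy_ge b0 nu0; lra.
  have := mulr_ge0 (ler0n R k) h.
  by rewrite /z0 /z1 /z2 -!natr1; nra.
have h1 := ler_wpM2l (ltW a0) (tangent z1).
have h2 := ler_wpM2l (ltW b0) (tangent z2).
apply: le_trans (lerD h1 h2).
have -> : a * (expR z0 * (1 + (z1 - z0))) + b * (expR z0 * (1 + (z2 - z0)))
  = expR z0 * ((a + b) + z0 - (a + b) * z0) by rewrite /z0; ring.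
by rewrite ab mul1r addrK mulr1.
Qed.

(** Nonnegativity of the relative entropy with respect to the uniform distribution. *)
Lemma entropy_le_ln2 a b : 0 < a -> 0 < b -> a + b = 1 ->
  2^-1 <= expR (a * ln a + b * ln b).
Proof.
move=> a0 b0 ab; rewrite -[leLHS]lnK ?posrE ?invr_gt0 // ler_expR.
have h2 : 0 < 2^-1 :> R by rewrite invr_gt0.
have := relative_entropy_ge a0 h2; have := relative_entropy_ge b0 h2.
have := congr1 (fun t => t * ln (2^-1 : R)) ab; rewrite mulrDl mul1r; lra.
Qed.

(** Here a ln a >= a - 1 = -b and, with s = sqrt b, b ln b = 2 s (s ln s) >= -2 s; both are
    controlled by s <= tau <= 1. *)
Lemma entropy_small a b tau : 0 < a -> 0 < b -> a + b = 1 ->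
  0 < tau -> tau <= 1 -> b <= tau ^+ 2 ->
  expR (- (3 * tau)) <= expR (a * ln a + b * ln b).
Proof.
move=> a0 b0 ab t0 t1 bt; rewrite ler_expR.
have := relative_entropy_ge a0 (ltr01 : 0 < 1 :> R); rewrite ln1 subr0 => ha.
set s := Num.sqrt b.
have s0 : 0 < s by rewrite sqrtr_gt0.
have sb : s ^+ 2 = b by rewrite sqr_sqrtr // ltW.
have st : s <= tau by rewrite -(@ler_pXn2r _ 2) ?nnegrE ?(ltW s0) ?(ltW t0) // sb.
have := relative_entropy_ge s0 (ltr01 : 0 < 1 :> R); rewrite ln1 subr0 => hs.
have lb : ln b = 2 * ln s by rewrite -sb lnXn // mulr_natl.
have : s * (s - 1) <= s * (s * ln s) by rewrite ler_pM2l.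
have -> : b * ln b = 2 * (s * (s * ln s)) by rewrite lb -{1}sb; ring.
have : tau ^+ 2 <= tau by rewrite expr2; nra.
nra.
Qed.

(** There are two regimes: 1/2 for every (a, b), nearly 1 for an unbalanced one. If a or b is 0, the
    logarithmic bound does not apply, but the sum is then 1 / l^k with 0 < l <= 1. *)
Lemma two_point_ge a b mu nu k :
  0 <= a -> 0 <= b -> a + b = 1 -> 0 < mu -> 0 < nu -> mu + nu = 1 ->
  2^-1 <= a ^+ k.+2 / mu ^+ k + b ^+ k.+2 / nu ^+ k /\
  (forall tau, 0 < tau -> tau <= 1 -> (a <= tau ^+ 2) || (b <= tau ^+ 2) ->
    expR (- (3 * tau)) <= a ^+ k.+2 / mu ^+ k + b ^+ k.+2 / nu ^+ k).
Proof.
move=> a0 b0 ab mu0 nu0 mn.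
suff key : 1 <= a ^+ k.+2 / mu ^+ k + b ^+ k.+2 / nu ^+ k \/ (0 < a) && (0 < b).
  have [h|/andP[a1 b1]] := key.
    split; first by apply: le_trans h; rewrite invf_le1 ?ler1n.
    by move=> tau t0 _ _; apply: le_trans h; rewrite expR_le1; lra.
  have h := two_point_exp k a1 b1 ab mu0 nu0 mn.
  split; first exact: le_trans (entropy_le_ln2 a1 b1 ab) h.
  move=> tau t0 t1 /orP[c|c]; apply: le_trans h.
    by rewrite addrC; apply: entropy_small; rewrite // addrC.
  exact: entropy_small.
have inv1 (l : R) : 0 < l -> l <= 1 -> 1 <= 1 / l ^+ k.
  by move=> l0 l1; rewrite div1r invf_ge1 ?exprn_gt0 // exprn_ile1 // ltW.
move: a0; rewrite le_eqVlt => /predU1P[a0|a0].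
  left; have -> : b = 1 by lra.
  by rewrite -a0 expr1n expr0n mul0r add0r; apply: inv1 => //; lra.
move: b0; rewrite le_eqVlt => /predU1P[b0|b0].
  left; have -> : a = 1 by lra.
  by rewrite -b0 expr1n expr0n mul0r addr0; apply: inv1 => //; lra.
by right; rewrite a0 b0.
Qed.

End TwoPoint.

(** * The moment inequality for one coordinate *)

Section TwoTermMoment.
Context {R : realType}.
Implicit Types u v P Q c K tau : R.

(** The smaller value W1 is at most the average, hence at most s^2 - 2 (1 - c) u v with s = u + v.
    Balance gives 2 u v >= tau^2 s^2, so W1^m <= (K - 1) s^(2m); W2 is bounded trivially. *)
Lemma sum_pow_le_of_min u v c tau W1 W2 K m :
  0 <= u -> 0 <= v -> 0 < u + v -> 0 <= c <= 1 ->
  tau ^+ 2 <= u / (u + v) -> tau ^+ 2 <= v / (u + v) ->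
  expR (- (m%:R * (tau ^+ 2 * (1 - c)))) <= K - 1 ->
  0 <= W1 -> W1 <= W2 -> W2 <= (u + v) ^+ 2 ->
  W1 + W2 <= 2 * (u ^+ 2 + v ^+ 2 + 2 * c * u * v) ->
  W1 ^+ m + W2 ^+ m <= K * ((u + v) ^+ 2) ^+ m.
Proof.
move=> u0 v0 s0 /andP[c0 c1] ta tb hK W10 W12 W2s hW.
set s := u + v in s0 ta tb W2s *.
have W2m : W2 ^+ m <= (s ^+ 2) ^+ m.
  by apply: lerXn2r; rewrite ?nnegrE ?sqr_ge0 //; exact: le_trans W12.
have W1m : W1 ^+ m <= (K - 1) * (s ^+ 2) ^+ m.
  have W1s : W1 <= expR (- (tau ^+ 2 * (1 - c))) * s ^+ 2.
    have h1 : 1 - tau ^+ 2 * (1 - c) <= expR (- (tau ^+ 2 * (1 - c))).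
      by have := expR_ge1Dx (- (tau ^+ 2 * (1 - c))).
    apply: le_trans (ler_wpM2r (sqr_ge0 s) h1).
    move: ta tb; rewrite !ler_pdivlMr // => ta tb.
    (* the smaller of the two entries is at least tau^2 s, the larger at least s/2 *)
    have huv : tau ^+ 2 * s * s <= 2 * u * v.
      have [uv|vu] := leP u v.
        have : 0 <= (u - tau ^+ 2 * s) * (2 * v) by rewrite !mulr_ge0 ?subr_ge0.
        have : 0 <= tau ^+ 2 * s * (v - u) by rewrite mulr_ge0 ?subr_ge0 // mulr_ge0 ?sqr_ge0 ?ltW.
        rewrite /s; nra.
      have : 0 <= (v - tau ^+ 2 * s) * (2 * u) by rewrite !mulr_ge0 ?subr_ge0.
      have : 0 <= tau ^+ 2 * s * (u - v) by rewrite mulr_ge0 ?subr_ge0 ?(ltW vu) // mulr_ge0 ?sqr_ge0 ?ltW.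
      rewrite /s; nra.
    have := ler_wpM2r (_ : 0 <= 1 - c) huv; rewrite subr_ge0 => /(_ c1).
    have -> : (1 - tau ^+ 2 * (1 - c)) * s ^+ 2 = s ^+ 2 - tau ^+ 2 * s * s * (1 - c) by ring.
    have : s ^+ 2 = u ^+ 2 + v ^+ 2 + 2 * u * v by rewrite /s; ring.
    move: hW W12; lra.
  apply: le_trans (ler_wpM2r (exprn_ge0 _ (sqr_ge0 s)) hK).
  rewrite -mulrN expRM_natl -exprMn; apply: lerXn2r; rewrite ?nnegrE //.
  by rewrite mulr_ge0 ?sqr_ge0 ?expR_ge0.
have -> : K * (s ^+ 2) ^+ m = (K - 1) * (s ^+ 2) ^+ m + (s ^+ 2) ^+ m by ring.
exact: lerD.
Qed.

(* u, v are the moduli of the partial sums over y_1 = 1 and y_1 = -1, P, Q the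
   sizes of these two parts, and W1, W2 the squared moduli of the full sum for the
   two values of x_1. If u and v are comparable, one of W1, W2 is exponentially
   small; if not, the right-hand side gains from the convexity of its powers. *)
Lemma two_term_moment u v P Q c K tau W1 W2 m :
  0 <= u -> 0 <= v -> 0 < P -> 0 < Q -> 0 <= c <= 1 ->
  0 < tau -> tau <= 1 -> expR (3 * tau) <= K ->
  expR (- (m.+1%:R * (tau ^+ 2 * (1 - c)))) <= K - 1 ->
  0 <= W1 -> 0 <= W2 -> W1 <= (u + v) ^+ 2 -> W2 <= (u + v) ^+ 2 ->
  W1 + W2 <= 2 * (u ^+ 2 + v ^+ 2 + 2 * c * u * v) ->
  W1 ^+ m.+1 + W2 ^+ m.+1 <= 2 * K * (P + Q) ^+ m.*2 *
    ((u ^+ 2) ^+ m.+1 / P ^+ m.*2 + (v ^+ 2) ^+ m.+1 / Q ^+ m.*2).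
Proof.
move=> u0 v0 P0 Q0 c01 t0 t1 hK1 hK2 W10 W20 W1s W2s hW.
have K0 : 0 < K by apply: lt_le_trans hK1; exact: expR_gt0.
have PQ0 : 0 < P + Q by exact: addr_gt0.
have [s0|s0] := leP (u + v) 0.
  have z : u + v = 0 by apply/eqP; rewrite eq_le s0 addr_ge0.
  move: W1s W2s; rewrite z expr0n /= => W1s W2s.
  have -> : W1 = 0 by apply/eqP; rewrite eq_le W1s.
  have -> : W2 = 0 by apply/eqP; rewrite eq_le W2s.
  rewrite expr0n addr0 !mulr_ge0 ?addr_ge0 ?mulr_ge0 ?invr_ge0 ?exprn_ge0 ?sqr_ge0 //;
    by apply: ltW.
set s := u + v in s0 W1s W2s *.
have ab : u / s + v / s = 1 by rewrite -mulrDl divff // gt_eqF.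
have mn : P / (P + Q) + Q / (P + Q) = 1 by rewrite -mulrDl divff // gt_eqF.
have [T1 T2] := two_point_ge m.*2 (divr_ge0 u0 (ltW s0)) (divr_ge0 v0 (ltW s0)) ab
  (divr_gt0 P0 PQ0) (divr_gt0 Q0 PQ0) mn.
set T := (_ + _) in T1 T2.
have S0 : 0 < (s ^+ 2) ^+ m.+1 by rewrite !exprn_gt0.
(* After normalising by s = u + v and by P + Q, the right-hand side contains the two-point sum T
   with a = u / s, mu = P / (P + Q) and k = 2m. *)
have -> : 2 * K * (P + Q) ^+ m.*2 *
    ((u ^+ 2) ^+ m.+1 / P ^+ m.*2 + (v ^+ 2) ^+ m.+1 / Q ^+ m.*2) =
    2 * K * (s ^+ 2) ^+ m.+1 * T.
  rewrite /T !expr_div_n -!exprM mul2n doubleS.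
  have := expf_neq0 m.*2.+2 (lt0r_neq0 s0); have := expf_neq0 m.*2 (lt0r_neq0 P0).
  have := expf_neq0 m.*2 (lt0r_neq0 Q0); have := expf_neq0 m.*2 (lt0r_neq0 PQ0).
  move: (s ^+ _) (P ^+ _) (Q ^+ _) ((P + Q) ^+ _) (u ^+ _) (v ^+ _) => x1 x2 x3 x4 x5 x6 h1 h2 h3 h4.
  by field; rewrite h1 h2 h3 h4.
(* In the unbalanced case K T >= 1, and the trivial bounds on W1 and W2 suffice. Otherwise only T >=
   1/2 is available, and the smallness of one of W1, W2 makes up for it. *)
have [small|] := boolP ((u / s <= tau ^+ 2) || (v / s <= tau ^+ 2)).
  have KT : 1 <= K * T.
    apply: le_trans (_ : expR (3 * tau) * expR (- (3 * tau)) <= _).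
      by rewrite -expRD subrr expR0.
    by apply: ler_pM; rewrite ?expR_ge0 // T2.
  have Wm W : 0 <= W -> W <= s ^+ 2 -> W ^+ m.+1 <= (s ^+ 2) ^+ m.+1.
    by move=> W0 h; apply: lerXn2r; rewrite ?nnegrE ?sqr_ge0.
  apply: le_trans (lerD (Wm _ W10 W1s) (Wm _ W20 W2s)) _.
  by have := ler_wpM2l (ltW S0) KT; lra.
rewrite negb_or -!ltNge => /andP[/ltW a1 /ltW b1].
apply: (@le_trans _ _ (K * (s ^+ 2) ^+ m.+1)); last first.
  by have := ler_wpM2l (mulr_ge0 (ltW K0) (ltW S0)) T1; lra.
have [W12|/ltW W12] := leP W1 W2.
  exact: (sum_pow_le_of_min u0 v0 s0 c01 a1 b1 hK2 W10 W12 W2s hW).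
rewrite addrC; apply: (sum_pow_le_of_min u0 v0 s0 c01 a1 b1 hK2 W20 W12 W1s).
by rewrite addrC.
Qed.

End TwoTermMoment.

(** * Splitting off the first coordinate of the cube *)

Lemma pm1N_subproof : (-1 : int) \in [:: 1; -1 : int].
Proof. by []. Qed.

(** [true] stands for -1, so that b encodes (-1)^b and a product of signs becomes an exclusive
    or. *)
Definition pm1_of_bool (b : bool) : pm1 :=
  if b then SeqSub pm1N_subproof else SeqSub pm1_subproof.

Lemma ssval_pm1_of_bool b : ssval (pm1_of_bool b) = (-1) ^+ b.
Proof. by case: b. Qed.

Lemma pm1_of_bool_bij : bijective pm1_of_bool.
Proof.
exists (fun s : pm1 => ssval s == -1); first by case.
move=> s; apply: val_inj; rewrite /= ssval_pm1_of_bool.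
by case: s => s /=; rewrite !inE => /orP[] /eqP ->.
Qed.

Section CubeCons.
Variable n : nat.

Definition cube_cons (s : bool) (y : cube n) : cube n.+1 :=
  [ffun i => if unlift ord0 i is Some j then y j else pm1_of_bool s].

Lemma cube_cons_bij : bijective (fun p : bool * cube n => cube_cons p.1 p.2).
Proof.
have [g gK Kg] := pm1_of_bool_bij.
exists (fun x : cube n.+1 => (g (x ord0), [ffun j => x (lift ord0 j)] : cube n)).
  case=> s y /=; congr pair; first by rewrite ffunE unlift_none.
  by apply/ffunP => j; rewrite !ffunE liftK.
move=> x; apply/ffunP => i; rewrite ffunE /=.
by case: unliftP => [j ->|->]; rewrite ?ffunE.
Qed.

Lemma sum_cubeS (V : nmodType) (F : cube n.+1 -> V) :
  \sum_x F x = \sum_x F (cube_cons false x) + \sum_x F (cube_cons true x).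
Proof.
rewrite (reindex (fun p : bool * cube n => cube_cons p.1 p.2)) /=; last first.
  exact: onW_bij cube_cons_bij.
by rewrite -(pair_bigA _ (fun s y => F (cube_cons s y))) big_bool addrC.
Qed.

Lemma inner_cons s t (x y : cube n) :
  inner (cube_cons s x) (cube_cons t y) = (-1) ^+ (s (+) t) + inner x y.
Proof.
rewrite /inner big_ord_recl !ffunE unlift_none !ssval_pm1_of_bool signr_addb.
by congr (_ + _); apply: eq_bigr => j _; rewrite !ffunE liftK.
Qed.

End CubeCons.

(** * Moments of character sums, by induction on the dimension *)

Section CharacterEnergy.
Context {R : realType}.
Implicit Type theta : R.

Definition cos_sum n (theta : R) (w : cube n -> R) (x : cube n) :=
  \sum_y w y * cos (theta * (inner x y)%:~R).
Definition sin_sum n (theta : R) (w : cube n -> R) (x : cube n) :=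
  \sum_y w y * sin (theta * (inner x y)%:~R).
(* The squared modulus of [\sum_y w(y) e^{i theta <x, y>}] *)
Definition energy n (theta : R) (w : cube n -> R) (x : cube n) :=
  cos_sum theta w x ^+ 2 + sin_sum theta w x ^+ 2.

Lemma energy_ge0 n theta (w : cube n -> R) x : 0 <= energy theta w x.
Proof. by rewrite addr_ge0 ?sqr_ge0. Qed.

Lemma cos_sum_shift n theta (w : cube n -> R) x (e : int) :
  \sum_y w y * cos (theta * (e + inner x y)%:~R) =
  cos (theta * e%:~R) * cos_sum theta w x - sin (theta * e%:~R) * sin_sum theta w x.
Proof.
rewrite /cos_sum /sin_sum !mulr_sumr -sumrB; apply: eq_bigr => y _.
by rewrite intrD mulrDr cosD; ring.
Qed.

Lemma sin_sum_shift n theta (w : cube n -> R) x (e : int) :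
  \sum_y w y * sin (theta * (e + inner x y)%:~R) =
  sin (theta * e%:~R) * cos_sum theta w x + cos (theta * e%:~R) * sin_sum theta w x.
Proof.
rewrite /cos_sum /sin_sum !mulr_sumr -big_split; apply: eq_bigr => y _.
by rewrite intrD mulrDr sinD /=; ring.
Qed.

Lemma cos_sign theta (s : bool) : cos (theta * ((-1) ^+ s : int)%:~R) = cos theta.
Proof. by case: s; rewrite ?expr0 ?expr1 ?mulrN1z ?mulr1 // mulrN1 cosN. Qed.

Lemma sin_sign theta (s : bool) :
  sin (theta * ((-1) ^+ s : int)%:~R) = (-1) ^+ s * sin theta.
Proof.
by case: s; rewrite ?expr0 ?expr1 ?mulrN1z ?mulr1 ?mul1r // mulrN1 sinN mulN1r.
Qed.

Section Recursion.
Variables (n : nat) (theta : R) (w : cube n.+1 -> R).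
Let w0 y := w (cube_cons false y).
Let w1 y := w (cube_cons true y).

(** With e = (-1)^s, the full sum is exp(i e theta) f_0 + exp(-i e theta) f_1, where f_0 and f_1 are
    the sums over the two halves of the cube. *)
Lemma energy_cons s (x : cube n) : energy theta w (cube_cons s x) =
  (cos theta * (cos_sum theta w0 x + cos_sum theta w1 x)
    - (-1) ^+ s * sin theta * (sin_sum theta w0 x - sin_sum theta w1 x)) ^+ 2
  + ((-1) ^+ s * sin theta * (cos_sum theta w0 x - cos_sum theta w1 x)
    + cos theta * (sin_sum theta w0 x + sin_sum theta w1 x)) ^+ 2.
Proof.
have hc t (z : cube n -> R) :
    \sum_y z y * cos (theta * (inner (cube_cons s x) (cube_cons t y))%:~R) =
    cos theta * cos_sum theta z x - (-1) ^+ (s (+) t) * sin theta * sin_sum theta z x.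
  by under eq_bigr do rewrite inner_cons; rewrite cos_sum_shift cos_sign sin_sign.
have hs t (z : cube n -> R) :
    \sum_y z y * sin (theta * (inner (cube_cons s x) (cube_cons t y))%:~R) =
    (-1) ^+ (s (+) t) * sin theta * cos_sum theta z x + cos theta * sin_sum theta z x.
  by under eq_bigr do rewrite inner_cons; rewrite sin_sum_shift cos_sign sin_sign.
rewrite {1}/energy {1}/cos_sum {1}/sin_sum !sum_cubeS !hc !hs addbF addbT -/w0 -/w1.
by case: {hc hs} s; rewrite ?expr0 ?expr1 /=; ring.
Qed.

End Recursion.

(** For z_j = c_j + i s_j, W e is the squared modulus of a sum of z_0 and z_1 rotated by opposite
    angles. In the proof a + i b is conj(z_0) z_1, and d, f are the cosine and sine of the doubled
    angle. Cauchy-Schwarz bounds each W e; in W 1 + W (-1) the terms in b f cancel. *)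
Lemma rotated_energy_bounds (co si c0 s0 c1 s1 : R) :
  co ^+ 2 + si ^+ 2 = 1 ->
  let u := Num.sqrt (c0 ^+ 2 + s0 ^+ 2) in let v := Num.sqrt (c1 ^+ 2 + s1 ^+ 2) in
  let W e := (co * (c0 + c1) - e * si * (s0 - s1)) ^+ 2
    + (e * si * (c0 - c1) + co * (s0 + s1)) ^+ 2 in
  [/\ W 1 <= (u + v) ^+ 2, W (-1) <= (u + v) ^+ 2 &
    W 1 + W (-1) <= 2 * (u ^+ 2 + v ^+ 2 + 2 * `|co ^+ 2 - si ^+ 2| * u * v)].
Proof.
move=> cs u v W.
have u0 : 0 <= u by exact: sqrtr_ge0.
have v0 : 0 <= v by exact: sqrtr_ge0.
have u2 : u ^+ 2 = c0 ^+ 2 + s0 ^+ 2 by rewrite sqr_sqrtr // addr_ge0 ?sqr_ge0.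
have v2 : v ^+ 2 = c1 ^+ 2 + s1 ^+ 2 by rewrite sqr_sqrtr // addr_ge0 ?sqr_ge0.
pose a := c0 * c1 + s0 * s1; pose b := c0 * s1 - s0 * c1.
have ab : a ^+ 2 + b ^+ 2 = (u * v) ^+ 2.
  by rewrite exprMn u2 v2 /a /b; ring.
have le_uv (t : R) : t ^+ 2 <= (u * v) ^+ 2 -> `|t| <= u * v.
  by move=> h; rewrite -[u * v]ger0_norm ?mulr_ge0 // -ler_sqr ?nnegrE // !real_normK ?num_real.
pose d := co ^+ 2 - si ^+ 2; pose f := 2 * co * si.
have df : d ^+ 2 + f ^+ 2 = 1.
  transitivity ((co ^+ 2 + si ^+ 2) ^+ 2); first by rewrite /d /f; ring.
  by rewrite cs expr1n.
have WE e : e ^+ 2 = 1 -> W e = u ^+ 2 + v ^+ 2 + 2 * (a * d + e * (b * f)).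
  move=> e1; rewrite u2 v2.
  (* The last summand vanishes for e^2 = 1; including it makes this a polynomial identity. The same
     device is used in the Lagrange identity below. *)
  have -> : W e = (co ^+ 2 + si ^+ 2) * (c0 ^+ 2 + s0 ^+ 2 + (c1 ^+ 2 + s1 ^+ 2))
      + 2 * (a * d + e * (b * f))
      + (e ^+ 2 - 1) * (si ^+ 2 * ((c0 - c1) ^+ 2 + (s0 - s1) ^+ 2)).
    by rewrite /W /a /b /d /f; ring.
  by rewrite cs e1 subrr mul0r mul1r addr0.
have Wle e : e ^+ 2 = 1 -> W e <= (u + v) ^+ 2.
  move=> e1; rewrite WE //.
  have : `|a * d + e * (b * f)| <= u * v.
    apply: le_uv; rewrite -ab -[leRHS]mul1r -df.
    have -> : (a * d + e * (b * f)) ^+ 2 =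
       (d ^+ 2 + f ^+ 2) * (a ^+ 2 + b ^+ 2) - (a * f - e * (b * d)) ^+ 2
       + (e ^+ 2 - 1) * ((b * f) ^+ 2 + (b * d) ^+ 2) by ring.
    by rewrite e1 subrr mul0r addr0 gerBl sqr_ge0.
  rewrite ler_norml => /andP[_ h].
  have -> : (u + v) ^+ 2 = u ^+ 2 + v ^+ 2 + 2 * (u * v) by ring.
  lra.
split; [by apply: Wle; rewrite expr1n|by apply: Wle; rewrite sqrrN expr1n|].
rewrite !WE ?sqrrN ?expr1n // -/d.
have h1 : `|a| <= u * v by apply: le_uv; rewrite -ab lerDl sqr_ge0.
have h2 : a * d <= `|d| * (u * v).
  apply: le_trans (ler_norm _) _; rewrite normrM mulrC.
  by rewrite ler_wpM2l.
lra.
Qed.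

(* Weights in [0, 1] rather than sets make the induction on the dimension close:
   at n = 0 the claim reads w^(2m+2) <= w^(2m+1). *)
Lemma moment_bound (theta K tau : R) m :
  0 < tau -> tau <= 1 -> expR (3 * tau) <= K ->
  expR (- (m.+1%:R * (tau ^+ 2 * (1 - `|cos theta ^+ 2 - sin theta ^+ 2|)))) <= K - 1 ->
  forall n (w : cube n -> R), (forall y, 0 <= w y <= 1) ->
  \sum_x energy theta w x ^+ m.+1 <= (2 * K) ^+ n * (\sum_y w y) ^+ m.*2.+1.
Proof.
move=> t0 t1 hK1 hK2.
have K0 : 0 <= K by apply: le_trans hK1; exact: expR_ge0.
have K1 : 1 <= K by apply: le_trans hK1; rewrite -[leLHS]expR0 ler_expR; lra.
have c01 : 0 <= `|cos theta ^+ 2 - sin theta ^+ 2| <= 1.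
  rewrite normr_ge0 ler_norml; have := cos2Dsin2 theta.
  by have := sqr_ge0 (cos theta); have := sqr_ge0 (sin theta); lra.
elim=> [w hw|n IH w hw].
  have cube0 (F : cube 0 -> R) : \sum_x F x = F [ffun=> pm1_of_bool false].
    rewrite (bigD1 [ffun=> pm1_of_bool false]) //= big1 ?addr0 // => x /eqP[].
    by apply/ffunP => -[].
  rewrite !cube0 /energy /cos_sum /sin_sum !cube0 /inner big_ord0 mulr0 cos0 sin0.
  rewrite !mulr0 expr0n addr0 mulr1 expr0 mul1r -exprM mul2n doubleS.
  have /andP[h0 h1] := hw [ffun=> pm1_of_bool false].
  by apply: ler_wiXn2l.
pose w0 y := w (cube_cons false y); pose w1 y := w (cube_cons true y).
have hw0 y : 0 <= w0 y <= 1 by exact: hw.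
have hw1 y : 0 <= w1 y <= 1 by exact: hw.
have IH0 := IH w0 hw0; have IH1 := IH w1 hw1.
rewrite !sum_cubeS -/(w0 _) -/(w1 _).
set P := \sum_x w (cube_cons false x); set Q := \sum_x w (cube_cons true x).
rewrite -/P in IH0; rewrite -/Q in IH1.
have P0 : 0 <= P by apply: sumr_ge0 => y _; have /andP[] := hw0 y.
have Q0 : 0 <= Q by apply: sumr_ge0 => y _; have /andP[] := hw1 y.
rewrite -big_split /=.
have sum0 (z : cube n -> R) : (forall y, 0 <= z y <= 1) -> \sum_y z y = 0 -> forall x,
    cos_sum theta z x = 0 /\ sin_sum theta z x = 0.
  move=> hz z0 x.
  have zz y : z y = 0.
    apply: (psumr_eq0P _ z0) => // i _; by have /andP[] := hz i.
  by split; apply: big1 => y _; rewrite zz mul0r.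
have cs := cos2Dsin2 theta.
have triv V : 0 <= V -> (2 * K) ^+ n * V * 2 <= (2 * K) ^+ n.+1 * V.
  move=> V0; rewrite exprSr -!mulrA ler_wpM2l ?exprn_ge0 ?mulr_ge0 //.
  by nra.
(* A half without weight rules out dividing by its total. The sum is then a rotation of the sum over
   the other half, so both values of x_1 give the same energy, and the factor 2 is covered by K >=
   1. *)
move: P0; rewrite le_eqVlt => /predU1P[P0|P0].
  rewrite -P0 add0r; apply: le_trans (triv _ (exprn_ge0 _ Q0)).
  apply: le_trans (ler_wpM2r _ IH1); rewrite // mulr_suml ler_sum // => x _.
  have [cz sz] := sum0 w0 hw0 (esym P0) x.
  rewrite !energy_cons /= -/w0 -/w1 cz sz expr0 expr1.
  have E e : e ^+ 2 = 1 -> (cos theta * (0 + cos_sum theta w1 x)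
      - e * sin theta * (0 - sin_sum theta w1 x)) ^+ 2
    + (e * sin theta * (0 - cos_sum theta w1 x)
      + cos theta * (0 + sin_sum theta w1 x)) ^+ 2 = energy theta w1 x.
    move=> e1; transitivity ((cos theta ^+ 2 + e ^+ 2 * sin theta ^+ 2) * energy theta w1 x).
      by rewrite /energy; ring.
    by rewrite e1 mul1r cs mul1r.
  by rewrite !E ?sqrrN ?expr1n //; lra.
move: Q0; rewrite le_eqVlt => /predU1P[Q0|Q0].
  rewrite -Q0 addr0; apply: le_trans (triv _ (exprn_ge0 _ (ltW P0))).
  apply: le_trans (ler_wpM2r _ IH0); rewrite // mulr_suml ler_sum // => x _.
  have [cz sz] := sum0 w1 hw1 (esym Q0) x.
  rewrite !energy_cons /= -/w0 -/w1 cz sz expr0 expr1.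
  have E e : e ^+ 2 = 1 -> (cos theta * (cos_sum theta w0 x + 0)
      - e * sin theta * (sin_sum theta w0 x - 0)) ^+ 2
    + (e * sin theta * (cos_sum theta w0 x - 0)
      + cos theta * (sin_sum theta w0 x + 0)) ^+ 2 = energy theta w0 x.
    move=> e1; transitivity ((cos theta ^+ 2 + e ^+ 2 * sin theta ^+ 2) * energy theta w0 x).
      by rewrite /energy; ring.
    by rewrite e1 mul1r cs mul1r.
  by rewrite !E ?sqrrN ?expr1n //; lra.
apply: (@le_trans _ _ (\sum_x 2 * K * (P + Q) ^+ m.*2 *
    (energy theta w0 x ^+ m.+1 / P ^+ m.*2 + energy theta w1 x ^+ m.+1 / Q ^+ m.*2))).
  apply: ler_sum => x _.
  have := rotated_energy_bounds (cos_sum theta w0 x) (sin_sum theta w0 x)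
    (cos_sum theta w1 x) (sin_sum theta w1 x) cs.
  move=> /=; set u := Num.sqrt _; set v := Num.sqrt _ => -[h1 h2 h3].
  have <- : u ^+ 2 = energy theta w0 x by rewrite sqr_sqrtr // energy_ge0.
  have <- : v ^+ 2 = energy theta w1 x by rewrite sqr_sqrtr // energy_ge0.
  apply: (two_term_moment (sqrtr_ge0 _) (sqrtr_ge0 _) P0 Q0 c01 t0 t1 hK1 hK2);
    by rewrite ?energy_ge0 // !energy_cons ?expr0 ?expr1.
rewrite -mulr_sumr big_split /= -!mulr_suml.
have pos (z : R) : 0 < z -> 0 <= (z ^+ m.*2)^-1 by move=> z0; rewrite invr_ge0 exprn_ge0 // ltW.
(* The induction hypothesis leaves P^(2m+1) / P^(2m) = P and likewise Q, so that the prefactor (P +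
   Q)^(2m) is completed to the power 2m + 1. *)
have hs := lerD (ler_wpM2r (pos _ P0) IH0) (ler_wpM2r (pos _ Q0) IH1).
apply: le_trans (ler_wpM2l _ hs) _.
  by rewrite !mulr_ge0 ?exprn_ge0 ?addr_ge0 // ltW.
rewrite le_eqVlt; apply/orP; left; apply/eqP.
rewrite [(2 * K) ^+ n.+1]exprS ![_ ^+ m.*2.+1]exprS.
have := expf_neq0 m.*2 (lt0r_neq0 P0); have := expf_neq0 m.*2 (lt0r_neq0 Q0).
move: (P ^+ m.*2) (Q ^+ m.*2) ((P + Q) ^+ m.*2) ((2 * K) ^+ n) => x1 x2 x3 x4 h1 h2.
by field; rewrite h1 h2.
Qed.

End CharacterEnergy.

(** * Markov's inequality for the energy *)

Section LargeEnergy.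
Context {R : realType}.

Definition set_weight n (B : {set cube n}) (y : cube n) : R := (y \in B)%:R.

Lemma sum_set_weight n (B : {set cube n}) : \sum_y set_weight B y = #|B|%:R.
Proof. by rewrite /set_weight -natr_sum -sum1_card [in RHS]big_mkcond. Qed.

(** The exponent is of order 1 / s^2 with s = sin (2 theta): large enough for the moment bound, yet
    with (m + 1) s^2 bounded, so that the loss in Markov's inequality stays below K^n. *)
Lemma moment_exponent_exists (K : R) : 1 < K ->
  exists2 c : R, 0 < c & forall theta : R, sin (theta *+ 2) != 0 ->
  exists m : nat, c * (m.+1%:R * sin (theta *+ 2) ^+ 2) <= ln K /\
  forall n (w : cube n -> R), (forall y, 0 <= w y <= 1) ->
  \sum_x energy theta w x ^+ m.+1 <= (2 * K) ^+ n * (\sum_y w y) ^+ m.*2.+1.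
Proof.
move=> K1; have lnK0 : 0 < ln K by rewrite ln_gt0.
pose tau := Num.min 1 (ln K / 3).
have t0 : 0 < tau by rewrite lt_min ltr01 divr_gt0.
have t1 : tau <= 1 by rewrite ge_min lexx.
have hK1 : expR (3 * tau) <= K.
  rewrite -[leRHS]lnK ?posrE ?(lt_trans ltr01) // ler_expR.
  have : tau <= ln K / 3 by rewrite ge_min lexx orbT.
  lra.
have K10 : 0 < K - 1 by rewrite subr_gt0.
have tK0 : 0 < (K - 1) * tau ^+ 2 by rewrite mulr_gt0 ?exprn_gt0.
(* With (m + 1) s^2 >= 2 L and s^2 <= 2 (1 - |cos (2 theta)|), the exponent z in the hypothesis of
   the moment bound is at least 1 / (K - 1), whence exp(-z) <= K - 1. *)
pose L := ((K - 1) * tau ^+ 2)^-1.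
have L0 : 0 < L by rewrite invr_gt0.
have L1 : 0 < 2 * L + 1 by lra.
exists (ln K / (2 * L + 1)); first by rewrite divr_gt0.
move=> theta; set s := sin _ => s0.
have s20 : 0 < s ^+ 2 by rewrite exprn_even_gt0.
pose m := Num.truncn (2 * L / s ^+ 2).
have : 0 <= 2 * L / s ^+ 2 by rewrite divr_ge0 ?sqr_ge0 // mulr_ge0 // ltW.
move=> /truncn_itv /andP[]; rewrite -/m => m1 m2.
have s21 : s ^+ 2 <= 1.
  by have := cos2Dsin2 (theta *+ 2); rewrite -/s; have := sqr_ge0 (cos (theta *+ 2)); lra.
exists m; split.
  rewrite mulrAC ler_pdivrMr // ler_pM2l //.
  move: m1; rewrite ler_pdivlMr // -natr1; nra.
move=> n w hw; apply: (moment_bound t0 t1 hK1) => //.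
set d := cos theta ^+ 2 - sin theta ^+ 2.
have ds : d ^+ 2 + s ^+ 2 = 1.
  transitivity ((cos theta ^+ 2 + sin theta ^+ 2) ^+ 2); last by rewrite cos2Dsin2 expr1n.
  by rewrite /d /s sin_mulr2n; ring.
have d1 : `|d| <= 1.
  by rewrite -(@ler_pXn2r _ 2) ?nnegrE // real_normK ?num_real // expr1n; lra.
have hc : s ^+ 2 <= 2 * (1 - `|d|).
  have : `|d| ^+ 2 = d ^+ 2 by rewrite real_normK ?num_real.
  nra.
move: m2; rewrite ltr_pdivrMr // => m2.
have hz : (K - 1)^-1 <= m.+1%:R * (tau ^+ 2 * (1 - `|d|)).
  have -> : (K - 1)^-1 = L * tau ^+ 2.
    by rewrite /L invfM -mulrA mulVf ?mulr1 // gt_eqF // exprn_gt0.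
  have : m.+1%:R * s ^+ 2 <= m.+1%:R * (2 * (1 - `|d|)) by rewrite ler_wpM2l.
  move=> h; have /(ler_wpM2l (sqr_ge0 tau)) : L <= m.+1%:R * (1 - `|d|) by lra.
  lra.
rewrite expRN invf_ple ?posrE ?expR_gt0 //.
apply: le_trans (expR_ge1Dx _); lra.
Qed.

(** Markov's inequality for the power m + 1 of the energy. The power of the threshold costs exp(c n
    s^2 (m + 1)) <= K^n, which turns (2 K)^n into (2 K^2)^n. *)
Lemma large_energy_count (K : R) : 1 < K ->
  exists2 c : R, 0 < c & forall (theta : R) n (B : {set cube n}),
  sin (theta *+ 2) != 0 -> (0 < #|B|)%N ->
  #|[set x : cube n | #|B|%:R ^+ 2 * expR (- (c * n%:R * sin (theta *+ 2) ^+ 2))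
      < energy theta (set_weight B) x]|%:R <= (2 * K ^+ 2) ^+ n / #|B|%:R :> R.
Proof.
move=> K1; have [c c0 hc] := moment_exponent_exists K1; exists c => //.
move=> theta n B /hc[m [hm mom]] B0; set s := sin _ in hm *.
set t := _ * expR _; set bad := [set x | _].
have b0 : 0 < #|B|%:R :> R by rewrite ltr0n.
have t0 : 0 < t by rewrite mulr_gt0 ?exprn_gt0 ?expR_gt0.
have K0 : 0 < K by exact: lt_trans K1.
have hw y : 0 <= set_weight B y <= 1 by rewrite /set_weight; case: (_ \in _); rewrite ?ler01 ?lexx.
have {mom} := mom n (set_weight B) hw; rewrite sum_set_weight => mom.
have : #|bad|%:R * t ^+ m.+1 <= (2 * K) ^+ n * #|B|%:R ^+ m.*2.+1.
  apply: le_trans mom; rewrite mulr_natl -sumr_const.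
  rewrite [leRHS](bigID (mem bad)) /= -[leLHS]addr0.
  apply: lerD; last by apply: sumr_ge0 => x _; rewrite exprn_ge0 ?energy_ge0.
  apply: ler_sum => x; rewrite inE => /ltW h.
  by apply: lerXn2r; rewrite ?nnegrE ?energy_ge0 // ltW.
rewrite -ler_pdivlMr ?exprn_gt0 // => /le_trans; apply.
rewrite ler_pdivrMr ?exprn_gt0 //.
have -> : t ^+ m.+1 = #|B|%:R ^+ m.*2.+2 * expR (- (c * n%:R * s ^+ 2)) ^+ m.+1.
  by rewrite /t exprMn -exprM mul2n doubleS.
rewrite [X in _ <= X](_ : _ = (2 * K) ^+ n * #|B|%:R ^+ m.*2.+1 *
    (K ^+ n * expR (- (c * n%:R * s ^+ 2)) ^+ m.+1)); last first.
  rewrite (expr2 K) mulrA [(2 * K * K) ^+ n]exprMn [_ ^+ m.*2.+2]exprS.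
  by field; rewrite gt_eqF.
rewrite ler_peMr ?mulr_ge0 ?exprn_ge0 ?mulr_ge0 ?(ltW K0) ?(ltW b0) //.
rewrite -expRM_natl -{1}(lnK (_ : K \in Num.pos)) ?posrE // -expRM_natl -expRD.
rewrite -[leLHS]expR0 ler_expR.
have := ler_wpM2l (ler0n R n) hm; lra.
Qed.

End LargeEnergy.

(** * Discrete Fourier inversion of the gap *)

Section Fourier.
Context {R : realType}.

Lemma sin_pi_frac_neq0 (z : int) (N : nat) : z != 0 -> (`|z| < N)%N ->
  sin (pi * z%:~R / N%:R) != 0 :> R.
Proof.
move=> z0 zN; have N0 : 0 < N%:R :> R by rewrite ltr0n; lia.
wlog zp : z z0 zN / 0 < z.
  move=> h; have [zp|zp] := ltP 0 z; first exact: h.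
  rewrite -oppr_eq0 -sinN -mulNr -mulrN -intrN; apply: h; rewrite ?oppr_eq0 ?abszN //.
  by rewrite oppr_gt0 lt_neqAle z0.
rewrite gt_eqF // sin_gt0_pi //; apply/andP; split.
  by rewrite divr_gt0 ?mulr_gt0 ?pi_gt0 // ltr0z.
rewrite ltr_pdivrMr // ltr_pM2l ?pi_gt0 //.
by rewrite -[N%:R]/(N%:~R) ltr_int; lia.
Qed.

Lemma sin_nat_pi (k : nat) (x : R) : sin (x + pi *+ 2 *+ k) = sin x.
Proof. by elim: k => [|k IH]; rewrite ?addr0 // mulrSr addrA sinD2pi. Qed.

Lemma sin_int_pi (z : int) (x : R) : sin (x + pi *+ 2 *~ z) = sin x.
Proof.
case: z => k; first exact: sin_nat_pi.
by rewrite NegzE mulrNz -[LHS](sin_nat_pi k.+1) subrK.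
Qed.

Definition freq (N j : nat) : R := pi *+ 2 * j%:R / N%:R.

(** With a = pi z / N, the product of sin a and cos (2 j a) is half of sin (2 j a + a) - sin (2 j a
    - a), so the sum telescopes over a full period. *)
Lemma sum_cos_freq (N : nat) (z : int) : (`|z| < N)%N ->
  \sum_(j < N) cos (freq N j * z%:~R) = N%:R * (z == 0)%:R.
Proof.
move=> zN; have N0 : N%:R != 0 :> R by rewrite pnatr_eq0; lia.
have [->|z0] := eqVneq z 0.
  by under eq_bigr do rewrite mulr0 cos0; rewrite sumr_const card_ord mulr1.
rewrite mulr0; set a := pi * z%:~R / N%:R : R.
have sa : sin a != 0 by exact: sin_pi_frac_neq0.
have /(mulfI sa) : sin a * \sum_(j < N) cos (freq N j * z%:~R) = sin a * 0; last exact.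
pose f (j : nat) : R := sin (a *+ 2 *+ j - a) / 2.
rewrite mulr0 mulr_sumr; transitivity (\sum_(j < N) (f j.+1 - f j)).
  apply: eq_bigr => j _; rewrite /f /freq.
  have -> : a *+ 2 *+ j.+1 - a = a *+ 2 *+ j + a by rewrite mulrSr mulr2n addrA addrK.
  have -> : pi *+ 2 * j%:R / N%:R * z%:~R = a *+ 2 *+ j.
    by rewrite /a -[_ *+ j]mulr_natr; ring.
  by rewrite sinD sinB; lra.
rewrite -(big_mkord xpredT (fun j => f j.+1 - f j)) telescope_sumr // /f.
have -> : a *+ 2 *+ N = pi *+ 2 *~ z.
  by rewrite /a -[_ *+ N]mulr_natr -[_ *~ z]mulrzr; field.
by rewrite [_ *~ z - a]addrC sin_int_pi mulr0n sub0r subrr.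
Qed.

Lemma abs_inner_le n (x y : cube n) : (`|inner x y| <= n)%N.
Proof.
rewrite -lez_nat abszE; apply: le_trans (ler_norm_sum _ _ _) _.
rewrite -[n in leRHS]card_ord -[leRHS]natz -sumr_const; apply: ler_sum => j _.
by rewrite normrM; case: (x j) (y j) => [s /=] + [t /=]; rewrite !inE => /orP[]/eqP-> /orP[]/eqP->.
Qed.

(* The shift by 4 contributes the factor sin (2 theta_j), which vanishes exactly at
   the frequencies where the character sums need not be small. *)
Lemma gap_indicator (N : nat) (z k : int) :
  (`|(z - k)%R| < N)%N -> (`|(z - k - 4)%R| < N)%N ->
  (z == k)%:R - (z == k + 4)%:R =
  - (2 / N%:R) * \sum_(j < N) sin (freq N j *+ 2) * sin (freq N j * (z - (k + 2))%:~R).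
Proof.
move=> h1 h2; have N0 : N%:R != 0 :> R by rewrite pnatr_eq0; lia.
rewrite -[z == k]subr_eq0 -[z == k + 4]subr_eq0 opprD addrA.
apply: (mulfI N0); rewrite mulrBr -sum_cos_freq // -sum_cos_freq // -sumrB.
rewrite mulrA [N%:R * _](_ : _ = -2); last by field.
rewrite mulr_sumr; apply: eq_bigr => j _; set t := freq N j.
(* Centred at k + 2, the two points lie at distance 2 on either side, and the difference of cosines
   becomes a product of sines. *)
have -> : t * (z - k)%:~R = t * (z - (k + 2))%:~R + t *+ 2.
  by ring.
have -> : t * (z - k - 4)%:~R = t * (z - (k + 2))%:~R - t *+ 2.
  by ring.
by rewrite cosD cosB; ring.
Qed.

(** For N = 4 (n + 1) and n > 0, all differences of inner products with k and k + 4 are below N in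
    absolute value once -n - 4 <= k <= n; for other k both indicators vanish. *)
Lemma gap_le_energy n (w : cube n -> R) (x : cube n) (k : int) : (0 < n)%N ->
  `|\sum_y w y * ((inner x y == k)%:R - (inner x y == k + 4)%:R)| <=
  2 / (4 * n.+1)%:R * \sum_(j < 4 * n.+1)
    `|sin (freq (4 * n.+1) j *+ 2)| * Num.sqrt (energy (freq (4 * n.+1) j) w x).
Proof.
move=> n0; set N := (4 * n.+1)%N.
have N0 : 0 < N%:R :> R by rewrite ltr0n.
have rhs0 : 0 <= 2 / N%:R * \sum_(j < N)
    `|sin (freq N j *+ 2)| * Num.sqrt (energy (freq N j) w x).
  by rewrite mulr_ge0 ?divr_ge0 ?sumr_ge0 // => j _; rewrite mulr_ge0 ?sqrtr_ge0.
have [kr|kr] := boolP ((- (n%:Z) - 4 <= k) && (k <= n%:Z)); last first.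
  rewrite big1 ?normr0 // => y _; have := abs_inner_le x y => h.
  have -> : (inner x y == k) = false by apply/negbTE/eqP; lia.
  have -> : (inner x y == k + 4) = false by apply/negbTE/eqP; lia.
  by rewrite subrr mulr0.
have E : \sum_y w y * ((inner x y == k)%:R - (inner x y == k + 4)%:R) =
    - (2 / N%:R) * \sum_(j < N) sin (freq N j *+ 2) *
      (cos (freq N j * (k + 2)%:~R) * sin_sum (freq N j) w x
       - sin (freq N j * (k + 2)%:~R) * cos_sum (freq N j) w x).
  rewrite mulr_sumr; transitivity (\sum_y \sum_(j < N) - (2 / N%:R) *
      (sin (freq N j *+ 2) * (w y * sin (freq N j * (inner x y - (k + 2))%:~R)))).
    apply: eq_bigr => y _; rewrite (@gap_indicator N); [|have := abs_inner_le x y; lia..].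
    by rewrite mulrA !mulr_sumr; apply: eq_bigr => j _; ring.
  rewrite exchange_big /=; apply: eq_bigr => j _; rewrite -!mulr_sumr; congr (_ * (_ * _)).
  rewrite /sin_sum /cos_sum !mulr_sumr -sumrB; apply: eq_bigr => y _.
  by rewrite intrB mulrBr sinB; ring.
rewrite E normrM normrN (ger0_norm (_ : 0 <= 2 / N%:R)) ?divr_ge0 // ler_wpM2l ?divr_ge0 //.
apply: le_trans (ler_norm_sum _ _ _) _; apply: ler_sum => j _.
rewrite normrM ler_wpM2l //; set t := freq N j * _.
(* One coordinate of the rotated vector ([cos_sum], [sin_sum]) is at most its length; the difference
   of squares is the other coordinate squared. *)
rewrite -sqrtr_sqr ler_wsqrtr // /energy.
rewrite -[leRHS]mul1r -(cos2Dsin2 t) -subr_ge0.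
rewrite [leRHS](_ : _ = (cos t * cos_sum (freq N j) w x + sin t * sin_sum (freq N j) w x) ^+ 2).
  exact: sqr_ge0.
ring.
Qed.

End Fourier.

(** * A bounded sum of sines with Gaussian damping *)

Section SineSums.
Context {R : realType}.
Implicit Types x c : R.

Lemma sin_mean_value x : 0 <= x -> exists2 t, 0 <= t <= x & sin x = cos t * x.
Proof.
move=> x0; have [|t] := @MVT_segment R sin cos 0 x x0.
  exact: (continuous_subspaceT (@continuous_sin R)).
by rewrite sin0 !subr0 in_itv /= => ? ?; exists t.
Qed.

Lemma sin_le_id x : 0 <= x -> sin x <= x.
Proof.
by move=> x0; have [t _ ->] := sin_mean_value x0; rewrite ler_piMl // cos_le1.
Qed.

(** The mean value theorem gives sin (x/2) >= cos (x/2) x/2, so sin x >= cos^2 (x/2) x, and 2 cos^2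
    (x/2) = 1 + cos x >= 1. *)
Lemma sin_ge_half x : 0 <= x <= pi / 2 -> x / 2 <= sin x.
Proof.
move=> /andP[x0 x1]; have y0 : 0 <= x / 2 by rewrite divr_ge0.
have [t /andP[t0 tx] st] := sin_mean_value y0.
have pi0 := @pi_gt0 R.
have cy : cos (x / 2) <= cos t.
  move: tx; rewrite le_eqVlt => /predU1P[->//|tx].
  by apply: ltW; rewrite ltr_cos // in_itv /=; apply/andP; split; lra.
have c0 : 0 <= cos (x / 2) by apply: cos_ge0_pihalf; apply/andP; split; lra.
have cx : 0 <= cos x by apply: cos_ge0_pihalf; apply/andP; split; lra.
have xE : x = (x / 2) *+ 2 by rewrite mulr2n; lra.
have h1 : cos (x / 2) * (cos (x / 2) * (x / 2)) <= cos (x / 2) * sin (x / 2).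
  by rewrite ler_wpM2l // st ler_wpM2r.
move: cx; rewrite [x in cos x]xE cos_mulr2n => cx.
rewrite [x in sin x]xE sin_mulr2n; nra.
Qed.

(* Differences of these weights telescope and dominate the terms of the sine sum. *)
Definition bump_weight (a : R) (M i : nat) : R := M%:R / (M%:R + a * i%:R ^+ 2).

Lemma bump_weight_bounds a M i : 0 <= a -> (0 < M)%N -> 0 <= bump_weight a M i <= 1.
Proof.
move=> a0 M0; have m0 : 0 < M%:R :> R by rewrite ltr0n.
have h : 0 <= a * i%:R ^+ 2 by rewrite mulr_ge0 ?sqr_ge0.
by rewrite divr_ge0 ?addr_ge0 // ler_pdivrMr ?mul1r ?lerDl // ltr_wpDr.
Qed.

(** As i / M <= s <= pi i / M, the exponential is at most (1 + a i^2 / M)^(-2), and the product with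
    s is comparable to the discrete derivative of [bump_weight]. The bound a <= c/4 serves the
    exponential, a <= 1 the comparison of consecutive denominators. *)
Lemma sin_gauss_pointwise c (M n i : nat) : 0 < c -> (0 < M)%N -> (M <= n.*2)%N ->
  (i.*2 <= M)%N -> 
  `|sin (pi * i%:R / M%:R)| * expR (- (c * n%:R * sin (pi * i%:R / M%:R) ^+ 2)) <=
  2 * pi / Num.min 1 (c / 4) *
    (bump_weight (Num.min 1 (c / 4)) M i - bump_weight (Num.min 1 (c / 4)) M i.+1).
Proof.
move=> c0 M0 Mn iM; set s := sin _; set a := Num.min _ _.
have m0 : 0 < M%:R :> R by rewrite ltr0n.
have m1 : 1 <= M%:R :> R by rewrite ler1n.
have a0 : 0 < a by rewrite lt_min ltr01 divr_gt0.
have a1 : a <= 1 by rewrite ge_min lexx.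
have ac : a <= c / 4 by rewrite ge_min lexx orbT.
have i0 : 0 <= i%:R :> R by [].
have pi0 := @pi_gt0 R; have pi2 := @pi_ge2 R.
have iM' : i%:R * 2 <= M%:R :> R by rewrite -natrM ler_nat muln2.
have Mn' : M%:R <= n%:R * 2 :> R by rewrite -natrM ler_nat muln2.
set x := pi * i%:R / M%:R in s *.
have x0 : 0 <= x by rewrite divr_ge0 ?mulr_ge0 // ltW.
have xpi : x <= pi / 2 by rewrite ler_pdivrMr //; nra.
have sx : s <= x by exact: sin_le_id.
have sx2 : i%:R / M%:R <= s.
  have : x / 2 <= s by apply: sin_ge_half; rewrite x0.
  apply: le_trans; rewrite /x [leRHS](_ : _ = pi / 2 * (i%:R / M%:R)); last by ring.
  by rewrite ler_peMl ?divr_ge0 ?(ltW m0) // ler_pdivlMr // mul1r.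
have s0 : 0 <= s by apply: le_trans sx2; rewrite divr_ge0 // ltW.
rewrite ger0_norm //.
pose D := M%:R + a * i%:R ^+ 2; pose D' := M%:R + a * i.+1%:R ^+ 2.
have D0 : 0 < D by rewrite ltr_wpDr // mulr_ge0 ?sqr_ge0 // ltW.
have D'0 : 0 < D' by rewrite ltr_wpDr // mulr_ge0 ?sqr_ge0 // ltW.
have D'D : D' <= 4 * D by rewrite /D' /D -natr1; nra.
have ex : expR (- (c * n%:R * s ^+ 2)) <= (M%:R / D) ^+ 2.
  have -> : M%:R / D = (1 + a * i%:R ^+ 2 / M%:R)^-1.
    by rewrite /D; field; rewrite -/D !gt_eqF //; rewrite mulr1.
  have h : 2 * (a * i%:R ^+ 2 / M%:R) <= c * n%:R * s ^+ 2.
    have h1 : (i%:R / M%:R) ^+ 2 <= s ^+ 2.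
      by rewrite lerXn2r ?nnegrE ?divr_ge0 // ltW.
    apply: (@le_trans _ _ (c * n%:R * (i%:R / M%:R) ^+ 2)); last first.
      by rewrite ler_wpM2l // mulr_ge0 // ltW.
    have -> : 2 * (a * i%:R ^+ 2 / M%:R) = (2 * a * M%:R) * (i%:R / M%:R) ^+ 2.
      by field; rewrite gt_eqF.
    rewrite ler_wpM2r ?sqr_ge0 //; nra.
  have y0 : 0 <= a * i%:R ^+ 2 / M%:R by rewrite divr_ge0 ?mulr_ge0 ?sqr_ge0 // ltW.
  apply: (@le_trans _ _ (expR (- (2 * (a * i%:R ^+ 2 / M%:R))))).
    by rewrite ler_expR lerN2.
  rewrite -mulrN (expRM_natl 2) expRN lerXn2r ?nnegrE ?invr_ge0 ?expR_ge0 ?addr_ge0 //.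
  by rewrite lef_pV2 ?posrE ?expR_gt0 ?ltr_wpDr // expR_ge1Dx.
apply: (@le_trans _ _ (x * (M%:R / D) ^+ 2)).
  by rewrite ler_pM ?expR_ge0.
rewrite /bump_weight -/D -/D'.
have -> : M%:R / D - M%:R / D' = M%:R * a * (2 * i%:R + 1) / (D * D').
  rewrite /D /D' -!natr1; field; rewrite -/D.
  by rewrite natr1 -/D' !gt_eqF.
have -> : x * (M%:R / D) ^+ 2 = pi * i%:R * M%:R * D' / (D * D * D').
  by rewrite /x; field; rewrite !gt_eqF.
have -> : 2 * pi / a * (M%:R * a * (2 * i%:R + 1) / (D * D')) =
   pi * (2 * (2 * i%:R + 1)) * M%:R * D / (D * D * D').
  by field; rewrite !gt_eqF.
rewrite ler_pM2r ?invr_gt0 ?mulr_gt0 //.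
have -> : pi * i%:R * M%:R * D' = (pi * M%:R) * (i%:R * D') by ring.
have -> : pi * (2 * (2 * i%:R + 1)) * M%:R * D = (pi * M%:R) * (2 * (2 * i%:R + 1) * D) by ring.
rewrite ler_pM2l ?mulr_gt0 //; nra.
Qed.

Lemma sum_periodic (g : nat -> R) (M k : nat) : (forall j, g (j + M)%N = g j) ->
  \sum_(0 <= j < k * M) g j = k%:R * \sum_(0 <= j < M) g j.
Proof.
move=> gM; have gkM i j : g (j + i * M)%N = g j.
  by elim: i => [|i IH]; rewrite ?addn0 // mulSn addnC -addnA [(_ + j)%N]addnC addnC gM.
elim: k => [|k IH]; first by rewrite mul0n big_geq // mul0r.
rewrite (@big_cat_nat _ _ _ (k * M)) //=; last by rewrite leq_mul2r leqnSn orbT.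
rewrite IH -{1}[(k * M)%N]add0n big_addn -mulnBl subSnn mul1n.
by under [X in _ + X]eq_bigr do rewrite gkM; rewrite -natr1 mulrDl mul1r.
Qed.

(** The terms have period M, whence the factor 4. Within a period, j and M - j give equal terms, so
    the pointwise bound on the first half covers everything. *)
Lemma sum_sin_gauss c : 0 < c -> exists2 C : R, 0 < C &
  forall M n : nat, (0 < M)%N -> (M <= n.*2)%N ->
  \sum_(0 <= j < 4 * M) `|sin (pi * j%:R / M%:R)|
     * expR (- (c * n%:R * sin (pi * j%:R / M%:R) ^+ 2)) <= C.
Proof.
move=> c0; pose a := Num.min 1 (c / 4).
have a0 : 0 < a by rewrite lt_min ltr01 divr_gt0.
have C0 : 0 < 2 * pi / a by rewrite divr_gt0 ?mulr_gt0 ?pi_gt0.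
exists (4 * (2 * pi / a * 2)); first by rewrite !mulr_gt0 ?pi_gt0 // invr_gt0.
move=> M n M0 Mn; have m0 : 0 < M%:R :> R by rewrite ltr0n.
pose g j := `|sin (pi * j%:R / M%:R)| * expR (- (c * n%:R * sin (pi * j%:R / M%:R) ^+ 2)).
have gM j : g (j + M)%N = g j.
  rewrite /g natrD mulrDr mulrDl mulfK ?gt_eqF //.
  by rewrite sinDpi normrN sqrrN.
rewrite (sum_periodic 4 gM) ler_pM2l //.
pose T i := bump_weight a M i.
have Tmono i : T i.+1 <= T i.
  rewrite /T /bump_weight ler_pM2l // lef_pV2 ?posrE ?ltr_wpDr ?mulr_ge0 ?sqr_ge0 ?(ltW a0) //.
  by rewrite lerD2l ler_pM2l // lerXn2r ?nnegrE // ler_nat.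
(* The second telescoping sum is for the reflected indices M - j; each of the two is at most 1. *)
apply: (@le_trans _ _ (2 * pi / a *
   (\sum_(0 <= j < M) - (T j.+1 - T j) + \sum_(0 <= j < M) (T (M.+1 - j.+1)%N - T (M.+1 - j)%N)))).
  rewrite -big_split /= mulr_sumr !big_mkord; apply: ler_sum => -[j jM] _ /=.
  have Mj : (M.+1 - j = (M - j).+1)%N by lia.
  rewrite opprB subSS Mj mulrDr.
  have pos i : 0 <= 2 * pi / a * (T i - T i.+1) by rewrite mulr_ge0 ?(ltW C0) // subr_ge0.
  have [h|h] := leqP j.*2 M.
    apply: le_trans (sin_gauss_pointwise c0 M0 Mn h) _.
    by rewrite lerDl pos.
  have h' : ((M - j).*2 <= M)%N by lia.
  have gr : g j = g (M - j)%N.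
    rewrite /g; congr (`|_| * expR (- (c * n%:R * (_ ^+ 2)))).
      rewrite natrB ?(ltnW jM) // mulrBr mulrBl mulfK ?gt_eqF // sinB sinpi cospi; lra.
    rewrite natrB ?(ltnW jM) // mulrBr mulrBl mulfK ?gt_eqF // sinB sinpi cospi; lra.
  rewrite gr; apply: le_trans (sin_gauss_pointwise c0 M0 Mn h') _.
  by rewrite lerDr pos.
rewrite ler_pM2l // sumrN (telescope_sumr T) // (telescope_sumr (fun j => T (M.+1 - j)%N)) //.
have Tb i : 0 <= T i <= 1 by exact: bump_weight_bounds (ltW a0) M0.
have /andP[_ u1] := Tb 0%N; have /andP[u2 _] := Tb M.
have /andP[_ u3] := Tb (M.+1 - M)%N; have /andP[u4 _] := Tb (M.+1 - 0)%N.
lra.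
Qed.

End SineSums.

(** * Counting the exceptional points x *)

Section ExceptionalSet.
Context {R : realType}.
Implicit Types (eps : R) (n : nat).

(** For the indicator weight of B this is |B| times the difference of the two probabilities. *)
Definition gap n (w : cube n -> R) (x : cube n) (k : int) : R :=
  \sum_y w y * ((inner x y == k)%:R - (inner x y == k + 4)%:R).

Lemma gap_le_card n (B : {set cube n}) x k : `|gap (set_weight B) x k| <= #|B|%:R.
Proof.
apply: le_trans (ler_norm_sum _ _ _) _; rewrite -sum_set_weight; apply: ler_sum => y _.
rewrite normrM ger0_norm ?ler0n // ler_piMr ?ler0n //.
have [->|_] := eqVneq (inner x y) k; last by rewrite sub0r normrN; case: eqP; rewrite ?normr1 ?normr0.
have -> : (k == k + 4) = false by apply/negbTE/eqP; lia.
by rewrite subr0 normr1.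
Qed.

(** From exp y >= y at y = eta n / 2, exp (eta n) >= (eta n / 2)^2 >= 8 n. This absorbs the number
    of frequencies in the union bound. *)
Lemma linear_le_exp (eta : R) n : 0 < eta -> 32 / eta ^+ 2 <= n%:R -> (0 < n)%N ->
  (4 * n.+1)%:R <= expR (eta * n%:R).
Proof.
move=> e0 hn n0; move: hn; rewrite ler_pdivrMr ?exprn_gt0 // => hn.
have n1 : 1 <= n%:R :> R by rewrite ler1n.
have -> : eta * n%:R = 2 * (eta * n%:R / 2) by lra.
rewrite (expRM_natl 2).
have h0 : 0 <= eta * n%:R / 2 by rewrite divr_ge0 ?mulr_ge0 // ltW.
have h : eta * n%:R / 2 <= expR (eta * n%:R / 2).
  by apply: le_trans (expR_ge1Dx _); lra.
have : (eta * n%:R / 2) ^+ 2 <= expR (eta * n%:R / 2) ^+ 2.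
  by rewrite lerXn2r ?nnegrE ?expR_ge0.
apply: le_trans; rewrite natrM -natr1.
have : 32 * n%:R <= n%:R * eta ^+ 2 * n%:R by rewrite ler_wpM2r.
nra.
Qed.

Lemma freq_double (M j : nat) : (0 < M)%N -> freq (4 * M) j *+ 2 = pi * j%:R / M%:R :> R.
Proof.
move=> M0; have m0 : M%:R != 0 :> R by rewrite pnatr_eq0 -lt0n.
by rewrite /freq natrM; field.
Qed.

Lemma gap_exception_count eps : 0 < eps -> exists2 C : R, 0 < C &
  forall n (B : {set cube n}), (0 < n)%N -> (0 < #|B|)%N ->
  #|[set x : cube n |
      `[< ~ forall k, `|gap (set_weight B) x k| <= C / n%:R * #|B|%:R >]]%SET|%:R
    <= 2 `^ ((1 + eps) * n%:R) / #|B|%:R :> R.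
Proof.
(* The excess 2^(eps n) is split in halves: exp (eta n) pays for the union bound, and K^(2n) for the
   moment estimate. *)
move=> e0; pose eta := eps * ln 2 / 2.
have ln20 : 0 < ln 2 :> R by rewrite ln_gt0 // ltr1n.
have eta0 : 0 < eta by rewrite divr_gt0 ?mulr_gt0.
pose K : R := 2 `^ (eps / 4).
have K1 : 1 < K.
  by rewrite /K /powR pnatr_eq0 /= expR_gt1 mulr_gt0 ?divr_gt0.
have [c c0 hc] := large_energy_count K1.
(* The constant is c / 2 because the energy is the square of the modulus. *)
have [C1 C10 hC1] := sum_sin_gauss (divr_gt0 c0 (ltr0n R 2)).
(* The second summand makes C / n >= 1 for small n, where the trivial bound on the gap leaves no
   exceptional point. *)
exists (C1 + 32 / eta ^+ 2); first by rewrite addr_gt0 ?divr_gt0 ?exprn_gt0.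
move=> n B n0 B0; set C := C1 + _; set bad := [set x | _]%SET.
have b0 : 0 < #|B|%:R :> R by rewrite ltr0n.
have nn0 : 0 < n%:R :> R by rewrite ltr0n.
have [small|large] := leP n%:R (32 / eta ^+ 2).
  suff -> : bad = finset.set0 by rewrite cards0 divr_ge0 ?powR_ge0.
  apply/setP => x; rewrite !inE; apply/negbTE/asboolPn; apply=> k.
  apply: le_trans (gap_le_card _ _ _) _; rewrite ler_peMl //.
  by rewrite ler_pdivlMr // mul1r; apply: le_trans small _; rewrite lerDr ltW.
pose s j : R := sin (freq (4 * n.+1) j *+ 2).
(* Frequencies with s j = 0 are left out, since their terms in the Fourier bound vanish. *)
pose badj (j : 'I_(4 * n.+1)) := [set x : cube n | (s j != 0) &&
  (#|B|%:R ^+ 2 * expR (- (c * n%:R * s j ^+ 2))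
    < energy (freq (4 * n.+1) j) (set_weight B) x)].
have sub : (bad \subset \bigcup_j badj j)%SET.
  apply/fintype.subsetP => x; apply: contraTT => nb; rewrite inE; apply/asboolPn; apply=> k.
  have hE (j : 'I_(4 * n.+1)) : `|s j| * Num.sqrt (energy (freq (4 * n.+1) j) (set_weight B) x)
      <= #|B|%:R * (`|s j| * expR (- (c / 2 * n%:R * s j ^+ 2))).
    have [->|sj] := eqVneq (s j) 0; first by rewrite normr0 !mul0r mulr0.
    rewrite mulrCA ler_wpM2l // -[leRHS]ger0_norm ?mulr_ge0 ?expR_ge0 //.
    rewrite -sqrtr_sqr ler_wsqrtr // exprMn -expRM_natl.
    have : x \notin badj j by apply: contra nb => h; apply/finset.bigcupP; exists j.
    rewrite inE sj /= -leNgt => /le_trans; apply.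
    by rewrite ler_wpM2l ?sqr_ge0 // ler_expR; lra.
  apply: le_trans (gap_le_energy _ _ _ n0) _.
  have M2 : (n.+1 <= n.*2)%N by lia.
  have hS := hC1 n.+1 n (ltn0Sn n) M2.
  have h4 : 0 < (4 * n.+1)%:R :> R by rewrite ltr0n.
  apply: (@le_trans _ _ (2 / (4 * n.+1)%:R * (#|B|%:R * C1))).
    rewrite ler_wpM2l ?divr_ge0 //.
    apply: (@le_trans _ _ (\sum_(j < 4 * n.+1)
        #|B|%:R * (`|s j| * expR (- (c / 2 * n%:R * s j ^+ 2))))).
      by apply: ler_sum => j _; exact: hE.
    rewrite -mulr_sumr ler_pM2l //; apply: le_trans hS; rewrite big_mkord.
    by apply: ler_sum => j _; rewrite /s freq_double.
  rewrite mulrCA mulrA [leRHS]mulrC -mulrA ler_pM2l // /C.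
  have : C1 / n%:R <= (C1 + 32 / eta ^+ 2) / n%:R.
    by rewrite ler_wpM2r ?invr_ge0 // lerDl divr_ge0 ?sqr_ge0.
  apply: le_trans; rewrite mulrC ler_pM2l // natrM invfM mulrA.
  rewrite -[leRHS]mul1r; apply: ler_pM; rewrite ?invr_ge0 ?divr_ge0 //.
    lra.
  by rewrite lef_pV2 ?posrE ?ltr0n // ler_nat.
have hbadj j : #|badj j|%:R <= (2 * K ^+ 2) ^+ n / #|B|%:R :> R.
  rewrite /badj; have [sj|sj] := eqVneq (s j) 0.
    rewrite (_ : [set x | _]%SET = finset.set0); last by apply/setP => x; rewrite !inE.
    by rewrite cards0 divr_ge0 // exprn_ge0 // mulr_ge0 ?sqr_ge0.
  exact: hc.
apply: (@le_trans _ _ (\sum_j #|badj j|%:R)).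
  rewrite -natr_sum ler_nat; apply: leq_trans (subset_leq_card sub) _.
  elim/big_rec2: _ => [|j x y _ h]; first by rewrite cards0.
  by apply: leq_trans (leq_card_setU _ _) _; rewrite leq_add2l.
apply: (@le_trans _ _ (\sum_(j < 4 * n.+1) (2 * K ^+ 2) ^+ n / #|B|%:R)).
  by apply: ler_sum => j _.
rewrite sumr_const card_ord -[leLHS]mulr_natl mulrA ler_pM2r ?invr_gt0 //.
have -> : 2 `^ ((1 + eps) * n%:R) = expR (eta * n%:R) * (2 * K ^+ 2) ^+ n.
  rewrite /K /powR pnatr_eq0 /=.
  have -> : 2 * expR (eps / 4 * ln 2) ^+ 2 = expR ((1 + eps / 2) * ln 2).
    by rewrite -expRM_natl [(1 + _) * _]mulrDl mul1r expRD lnK ?posrE //; congr (_ * expR _); field.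
  by rewrite -expRM_natl -expRD; congr expR; rewrite /eta; field.
rewrite ler_pM2r; last by rewrite exprn_gt0 // mulr_gt0 // exprn_gt0 // (lt_trans _ K1).
exact: linear_le_exp (ltW large) n0.
Qed.

End ExceptionalSet.

(** * From probabilities to finite sums *)

Section FiniteRange.
Context d (T : measurableType d) (R : realType) (P : probability T R).

(** Measurability is asked of the fibres only, so that the lemma also applies to the pair (X, Y). *)
Lemma Pr_finite_sum (I : finType) (f : T -> I) (E : pred I) :
  (forall i, measurable (f @^-1` [set i]%classic)) ->
  Pr P [set w | E (f w)]%classic = \sum_i (E i)%:R * Pr P [set w | f w = i]%classic.
Proof.
move=> mf; pose F i : set T := if E i then (f @^-1` [set i])%classic else set0.
have -> : [set w | E (f w)]%classic = (\bigcup_(i in [set` index_enum I]) F i)%classic.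
  apply/seteqP; split => w /=; first by move=> h; exists (f w); rewrite /= ?mem_index_enum // /F h.
  by move=> [i _]; rewrite /F; case: ifP => [h /= ->|_ []].
rewrite /Pr measure_fin_bigcup //.
- rewrite -fsbig_seq ?index_enum_uniq // -sum_fine => [|i _]; last first.
    by rewrite /F; case: ifP => _; rewrite ?measure0 // fin_num_measure.
  apply: eq_bigr => i _; rewrite /F; case: (E i); first by rewrite mul1r.
  by rewrite measure0 mul0r.
- by move=> i j _ _ [w []]; rewrite /F; case: ifP => [_ <-|_ []]; case: ifP => [_ <-|_ []].
- by move=> i _; rewrite /F; case: ifP.
Qed.

Lemma measurable_cube_fiber n (Y : {RV P >-> cube n}) y :
  measurable (Y @^-1` [set y]%classic).
Proof. by rewrite -[X in measurable X]setTI; apply: (measurable_funP Y). Qed.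

Lemma Pr_inner_gap n (B : {set cube n}) (Y : {RV P >-> cube n}) x k :
  uniform_on B Y ->
  Pr P [set w | inner x (Y w) = k]%classic
    - Pr P [set w | inner x (Y w) = k + 4]%classic
  = #|B|%:R^-1 * gap (set_weight B) x k.
Proof.
move=> hY.
have E l : Pr P [set w | inner x (Y w) = l]%classic =
    \sum_y (inner x y == l)%:R * (#|B|%:R^-1 * set_weight B y).
  rewrite -(_ : [set w | inner x (Y w) == l] = [set w | inner x (Y w) = l])%classic; last first.
    by apply/seteqP; split=> w /= /eqP.
  rewrite (Pr_finite_sum (fun y => inner x y == l) (measurable_cube_fiber Y)).
  apply: eq_bigr => y _; rewrite hY /set_weight.
  by case: (y \in B); rewrite ?mulr1 ?mulr0.
by rewrite !E -sumrB /gap mulr_sumr; apply: eq_bigr => y _; ring.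
Qed.

Lemma Pr_inner_gap_indep n (A B : {set cube n}) (X Y : {RV P >-> cube n}) k :
  uniform_on A X -> uniform_on B Y -> independent_RV X Y ->
  Pr P [set w | inner (X w) (Y w) = k]%classic
    - Pr P [set w | inner (X w) (Y w) = k + 4]%classic
  = \sum_(x in A) #|A|%:R^-1 * (#|B|%:R^-1 * gap (set_weight B) x k).
Proof.
move=> hX hY hXY.
have mXY (p : cube n * cube n) : measurable ((fun w => (X w, Y w)) @^-1` [set p]%classic).
  rewrite (_ : _ @^-1` _ = X @^-1` [set p.1] `&` Y @^-1` [set p.2])%classic; last first.
    by case: p => a b; apply/seteqP; split=> w /= [-> ->].
  by apply: measurableI; exact: measurable_cube_fiber.
have E l : Pr P [set w | inner (X w) (Y w) = l]%classic =
    \sum_x \sum_y (inner x y == l)%:R *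
      ((#|A|%:R^-1 * set_weight A x) * (#|B|%:R^-1 * set_weight B y)).
  rewrite -(_ : [set w | inner (X w) (Y w) == l] = [set w | inner (X w) (Y w) = l])%classic; last first.
    by apply/seteqP; split=> w /= /eqP.
  rewrite (Pr_finite_sum (fun p : cube n * cube n => inner p.1 p.2 == l) mXY).
  rewrite pair_bigA /=; apply: eq_bigr => -[x y] _ /=; congr (_ * _).
  have -> : [set w | (X w, Y w) = (x, y)]%classic
      = (X @^-1` [set x] `&` Y @^-1` [set y])%classic.
    by apply/seteqP; split=> w /= [-> ->].
  rewrite /Pr hXY // fineM ?fin_num_measure //; try exact: measurable_cube_fiber.
  congr (_ * _).
    by have := hX x; rewrite /Pr => ->; rewrite /set_weight; case: (x \in A); rewrite ?mulr1 ?mulr0.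
  by have := hY y; rewrite /Pr => ->; rewrite /set_weight; case: (y \in B); rewrite ?mulr1 ?mulr0.
rewrite !E -sumrB [RHS]big_mkcond /=; apply: eq_bigr => x _.
rewrite -sumrB /gap /set_weight; case: (x \in A); last first.
  by apply: big1 => y _; rewrite !(mulr0, mul0r) subrr.
by rewrite !mulr_sumr; apply: eq_bigr => y _; rewrite [(true)%:R](_ : _ = 1) //; ring.
Qed.

End FiniteRange.

(** * Averaging over x and conclusion *)

Lemma mean_le_exceptional (R : realType) (I : finType) (A bad : {set I}) (g : I -> R) (c : R) :
  0 <= c -> (0 < #|A|)%N -> (forall x, `|g x| <= 1) ->
  (forall x, x \notin bad -> `|g x| <= c) ->
  `|\sum_(x in A) #|A|%:R^-1 * g x| <= c + #|bad|%:R / #|A|%:R.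
Proof.
move=> c0 A0 g1 gc; have a0 : 0 < #|A|%:R :> R by rewrite ltr0n.
rewrite -mulr_sumr normrM ger0_norm ?invr_ge0 //.
rewrite mulrC ler_pdivrMr // mulrDl divfK ?gt_eqF //.
apply: le_trans (ler_norm_sum _ _ _) _.
apply: (@le_trans _ _ (\sum_(x in A) (c + (x \in bad)%:R))).
  apply: ler_sum => x _; case: (boolP (x \in bad)) => h; last by rewrite addr0 gc.
  by apply: le_trans (g1 x) _; rewrite lerDr.
rewrite big_split /= sumr_const mulr_natr lerD2l -natr_sum ler_nat.
rewrite -big_mkcondr /= sum1dep_card; apply: subset_leq_card.
by apply/fintype.subsetP => x; rewrite inE => /andP[].
Qed.

Theorem theorem3 (R : realType) (beta eps : R) (hbeta : 0 < beta) (heps : 0 < eps) :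
  exists C : R, 0 < C /\
    forall (n : nat), (0 < n)%N ->
    forall (B : {set cube n}), #|B|%:R = 2 `^ (beta * n%:R) ->
    forall (d : measure_display) (T : measurableType d) (P : probability T R)
      (Y : {RV P >-> cube n}), uniform_on B Y ->
      #|[set x : cube n |
          `[< ~ max_gap4_le P (fun w => inner x (Y w)) (C / n%:R) >]]%SET|%:R
        <= 2 `^ ((1 - beta + eps) * n%:R)
      /\
      forall (A : {set cube n}),
        #|A|%:R = 2 `^ ((1 - beta + 2 * eps) * n%:R) ->
      forall (X : {RV P >-> cube n}), uniform_on A X -> independent_RV X Y ->
        max_gap4_le P (fun w => inner (X w) (Y w))
          (C / n%:R + 2 `^ (- (eps * n%:R))).
Proof.
have [C C0 hC] := @gap_exception_count R eps heps.
exists C; split=> // n n0 B hB d T P Y hY.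
have b0 : 0 < #|B|%:R :> R by rewrite hB powR_gt0.
have B0 : (0 < #|B|)%N by rewrite ltr0n in b0.
have nn0 : 0 < n%:R :> R by rewrite ltr0n.
have normE x k : `|#|B|%:R^-1 * gap (set_weight B) x k| = `|gap (set_weight B) x k| / #|B|%:R.
  by rewrite normrM ger0_norm ?invr_ge0 // mulrC.
set bad := [set x | _]%SET.
have hbad : #|bad|%:R <= 2 `^ ((1 - beta + eps) * n%:R) :> R.
  (* The size of B enters here: dividing by |B| = 2^(beta n) lowers the exponent by beta n. *)
  have -> : 2 `^ ((1 - beta + eps) * n%:R) = 2 `^ ((1 + eps) * n%:R) / #|B|%:R :> R.
    rewrite hB -powRB ?pnatr_eq0 ?implybT //; congr (_ `^ _); ring.
  apply: le_trans (hC n B n0 B0); rewrite ler_nat; apply: subset_leq_card.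
  apply/fintype.subsetP => x; rewrite !finset.in_set => /asboolP h; apply/asboolP => g; apply: h => k.
  by rewrite (Pr_inner_gap _ _ hY) normE ler_pdivrMr // g.
split=> // A hA X hX hXY k.
have a0 : 0 < #|A|%:R :> R by rewrite hA powR_gt0.
rewrite (Pr_inner_gap_indep _ hX hY hXY).
apply: (@le_trans _ _ (C / n%:R + #|bad|%:R / #|A|%:R)).
  apply: mean_le_exceptional; rewrite ?divr_ge0 ?ltW //; first by rewrite ltr0n in a0.
    by move=> x; rewrite normE ler_pdivrMr // mul1r gap_le_card.
  move=> x; rewrite inE => /asboolPn/contrapT/(_ k).
  by rewrite (Pr_inner_gap _ _ hY).
(* The exceptional set has density at most 2^(-eps n) in A, as the exponents differ by eps n. *)
rewrite lerD2l ler_pdivrMr // hA -powRD ?pnatr_eq0 ?implybT //.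
by apply: le_trans hbad _; rewrite le_eqVlt; apply/orP; left; apply/eqP; congr (_ `^ _); ring.
Qed.
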